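(* Let $X$ be a normal modal logic and let $I$ be an index set with $\omega\subseteq I$. Suppose that $X$ is complete with respect to a set of Kripke frames $F=\{(G_\alpha,R_\alpha):\alpha\in I\}$, where for every $\alpha\in I$, $G_\alpha$ is a nonempty infinite set and $R_\alpha$ is an accessibility relation (a binary relation) on $G_\alpha$. Let $H=\{(G_i^*,R_i^* ): i\in\omega\}$ be a set of Kripke frames such that for every $i\in\omega$: $$G_i^*=\{*,g_0,g_1,\dots,g_i\}\cup G_{\omega i},$$ where $G_{\omega i}=\{\eta_{ij}: j\in\omega\}$ has cardinality $\aleph_0$, $\{*,g_0,\dots,g_i\}\cap G_{\omega i}=\emptyset$, the elements $*,g_0,\dots,g_i$ are distinct, and $$R_i^*=\{( *,g_j):0\le j\le i\}\cup\{(g_j,* ):0\le j\le i\}\cup\{(g_j,g_k): j\ne k,\ 1\le j\le i,\ 1\le k\le i\}\cup\{(\eta,\eta):\eta\in G_{\omega i}\}.$$ If $H\subseteq F$, then $B$-translation is faithful with respect to $X$.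
   Context: The system $\mathbf{L_1}$ (Leśniewski's propositional ontology): fix a countably infinite set of name variables. The atomic formulas are exactly the expressions $\epsilon ab$ with $a,b$ name variables (possibly equal); formulas are built from atomic formulas by $\vee$ and $\neg$, the other connectives being the usual classical abbreviations. $\mathbf{L_1}$ is a Hilbert-style system of classical propositional logic (with modus ponens) over these formulas with the additional axiom schemata, for all name variables $a,b,c$: (Ax1) $\epsilon ab \supset \epsilon aa$; (Ax2) $(\epsilon ab \wedge \epsilon bc) \supset \epsilon ac$; (Ax3) $(\epsilon ab \wedge \epsilon bc) \supset \epsilon ba$. $B$-translation: to each name variable $a$ corresponds a propositional variable $p_a$, with distinct name variables corresponding to distinct propositional variables. $B$ maps formulas of $\mathbf{L_1}$ to propositional modal formulas by $B(\phi\vee\psi)=B(\phi)\vee B(\psi)$, $B(\neg\phi)=\neg B(\phi)$, $B(\epsilon ab)=p_a\wedge\Box(p_a\supset p_b)\wedge\bigl(p_b\supset\Box(p_b\supset p_a)\bigr)$. $B$-translation is faithful with respect to a modal logic $X$ if for every formula $\phi$ of $\mathbf{L_1}$, $\vdash_X B(\phi)$ implies $\vdash_{\mathbf{L_1}}\phi$. A normal modal logic is a set $X$ of propositional modal formulas with $\mathbf{K}\subseteq X$ that is closed under modus ponens, substitution and necessitation. $X$ is complete with respect to a set $F$ of Kripke frames if, for every modal formula $\chi$, $\vdash_X\chi$ holds if and only if $\chi$ is valid in every frame in $F$. *)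

(* Defs.v *)
From mathcomp Require Import all_boot all_classical.

Set Implicit Arguments.
Unset Strict Implicit.
Unset Printing Implicit Defensive.

Local Open Scope classical_set_scope.

Definition name := nat.
Definition pvar := nat.

Inductive lform : Type :=
| LEps of name & name
| LOr of lform & lform
| LNot of lform.

Definition LImp (A B : lform) : lform := LOr (LNot A) B.
Definition LAnd (A B : lform) : lform := LNot (LOr (LNot A) (LNot B)).

(* The first four schemata are the Hilbert-Ackermann axioms of classical
   propositional logic in the primitives "or" and "not". *)
Inductive L1_thm : lform -> Prop :=
| L1_idem A : L1_thm (LImp (LOr A A) A)
| L1_weak A B : L1_thm (LImp A (LOr A B))
| L1_perm A B : L1_thm (LImp (LOr A B) (LOr B A))
| L1_sum A B C : L1_thm (LImp (LImp B C) (LImp (LOr A B) (LOr A C)))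
| L1_ax1 a b : L1_thm (LImp (LEps a b) (LEps a a))
| L1_ax2 a b c : L1_thm (LImp (LAnd (LEps a b) (LEps b c)) (LEps a c))
| L1_ax3 a b c : L1_thm (LImp (LAnd (LEps a b) (LEps b c)) (LEps b a))
| L1_mp A B : L1_thm A -> L1_thm (LImp A B) -> L1_thm B.

Inductive mform : Type :=
| MVar of pvar
| MOr of mform & mform
| MNot of mform
| MBox of mform.

Definition MImp (A B : mform) : mform := MOr (MNot A) B.
Definition MAnd (A B : mform) : mform := MNot (MOr (MNot A) (MNot B)).

Inductive K_thm : mform -> Prop :=
| K_idem A : K_thm (MImp (MOr A A) A)
| K_weak A B : K_thm (MImp A (MOr A B))
| K_perm A B : K_thm (MImp (MOr A B) (MOr B A))
| K_sum A B C : K_thm (MImp (MImp B C) (MImp (MOr A B) (MOr A C)))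
| K_dist A B : K_thm (MImp (MBox (MImp A B)) (MImp (MBox A) (MBox B)))
| K_mp A B : K_thm A -> K_thm (MImp A B) -> K_thm B
| K_nec A : K_thm A -> K_thm (MBox A).

Fixpoint msubst (s : pvar -> mform) (A : mform) : mform :=
  match A with
  | MVar q => s q
  | MOr A1 A2 => MOr (msubst s A1) (msubst s A2)
  | MNot A1 => MNot (msubst s A1)
  | MBox A1 => MBox (msubst s A1)
  end.

Definition normal_logic (X : set mform) : Prop :=
  [/\ K_thm `<=` X,
      forall A B, X A -> X (MImp A B) -> X B,
      forall s A, X A -> X (msubst s A)
    & forall A, X A -> X (MBox A)].

(* Frames live inside an ambient type U, so that two frames can be compared
   by plain equality and inclusions between sets of frames are literal. *)
Record frame (U : Type) := Frame {
  world : set U;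
  acc : set (U * U);
  world_neq0 : world !=set0;
  acc_world : acc `<=` world `*` world }.

Fixpoint forces (U : Type) (G : frame U) (V : pvar -> set U) (w : U)
    (A : mform) : Prop :=
  match A with
  | MVar q => V q w
  | MOr A1 A2 => forces G V w A1 \/ forces G V w A2
  | MNot A1 => ~ forces G V w A1
  | MBox A1 => forall v, acc G (w, v) -> forces G V v A1
  end.

(* V may be arbitrary outside world G: by acc_world this has no effect on the
   truth of formulas at points of world G. *)
Definition frame_valid (U : Type) (G : frame U) (A : mform) : Prop :=
  forall (V : pvar -> set U) (w : U), world G w -> forces G V w A.

Definition complete_wrt (U : Type) (X : set mform) (F : set (frame U)) : Prop :=
  forall A, X A <-> forall G, F G -> frame_valid G A.

Fixpoint Btrans (p : name -> pvar) (A : lform) : mform :=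
  match A with
  | LEps a b =>
      MAnd (MAnd (MVar (p a)) (MBox (MImp (MVar (p a)) (MVar (p b)))))
           (MImp (MVar (p b)) (MBox (MImp (MVar (p b)) (MVar (p a)))))
  | LOr A1 A2 => MOr (Btrans p A1) (Btrans p A2)
  | LNot A1 => MNot (Btrans p A1)
  end.

Definition Bfaithful (p : name -> pvar) (X : set mform) : Prop :=
  forall A, X (Btrans p A) -> L1_thm A.

(* Main.v *)
(** If [A] is not provable, some [L1]-theory [T] omits [A] and decides all its
    subformulas.  Let [N] bound the names of [A] and, on the frame [H N], make
    [p a] true at [g k] iff [T] contains [LEps k a], and at [star] iff [T]
    contains [LEps a a].  The successors of [star] are [g 0, ..., g N], so by
    the three axioms [star] forces the translation of [LEps a b] iff [T]
    contains [LEps a b]: the world [g a] witnesses the converse.  Hence [star]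
    refutes the translation of [A]. *)
Require Import Defs.
From mathcomp Require Import all_boot all_classical.

Local Open Scope classical_set_scope.

(** * Propositional reasoning inside theories *)

(** Consistency is not built in; below it is tracked by naming a formula [C] outside the theory. *)
Definition L1_theory (T : set lform) : Prop :=
  L1_thm `<=` T /\ forall A B, T A -> T (LImp A B) -> T B.

Section Theory.
Variables (T : set lform) (T_theory : L1_theory T).

Let thm A : L1_thm A -> T A. Proof. exact: T_theory.1. Qed.

Lemma L1_theory_mp A B : T (LImp A B) -> T A -> T B.
Proof. by move=> AB tA; apply: T_theory.2 AB. Qed.

Lemma L1_theory_orl A B : T A -> T (LOr A B).
Proof. exact/L1_theory_mp/thm/L1_weak. Qed.

Lemma L1_theory_orC A B : T (LOr A B) -> T (LOr B A).
Proof. exact/L1_theory_mp/thm/L1_perm. Qed.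

Lemma L1_theory_orr A B : T B -> T (LOr A B).
Proof. by move=> tB; apply/L1_theory_orC/L1_theory_orl. Qed.

Lemma L1_theory_or_imp A B C : T (LImp B C) -> T (LOr A B) -> T (LOr A C).
Proof. by move=> BC; apply/L1_theory_mp/(L1_theory_mp _ _ _ BC)/thm/L1_sum. Qed.

Lemma L1_theory_imp_trans B A C : T (LImp A B) -> T (LImp B C) -> T (LImp A C).
Proof. by move=> AB BC; apply: L1_theory_or_imp AB. Qed.

Lemma L1_theory_imp_refl A : T (LImp A A).
Proof. exact: L1_theory_imp_trans (thm _ (L1_weak A A)) (thm _ (L1_idem A)). Qed.

Lemma L1_theory_orE A B C :
  T (LOr A B) -> T (LImp A C) -> T (LImp B C) -> T C.
Proof.
move=> AB AC BC; apply: L1_theory_mp (thm _ (L1_idem C)) _.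
by apply: (L1_theory_or_imp _ A) => //; apply/L1_theory_orC/(L1_theory_or_imp _ B).
Qed.

Lemma L1_theory_em A : T (LOr A (LNot A)).
Proof. exact/L1_theory_orC/L1_theory_imp_refl. Qed.

Lemma L1_theory_absurd A B : T A -> T (LNot A) -> T B.
Proof. by move=> tA /(L1_theory_orl _ B) AB; apply: L1_theory_mp AB tA. Qed.

Lemma L1_theory_impC A B C :
  T (LImp A (LImp B C)) -> T (LImp B (LImp A C)).
Proof.
(* The hypothesis is the disjunction of [LNot A] and [LImp B C]; each disjunct implies the goal. *)
move=> ABC; apply: (L1_theory_orE _ _ _ ABC).
  apply: (L1_theory_imp_trans (LImp A C)); first exact/thm/L1_weak.
  apply: (L1_theory_imp_trans (LOr (LImp A C) (LNot B))).
    exact/thm/L1_weak.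
  exact/thm/L1_perm.
apply: L1_theory_mp (thm _ (L1_sum _ _ _)) _.
apply: (L1_theory_imp_trans (LOr C (LNot A))); first exact/thm/L1_weak.
exact/thm/L1_perm.
Qed.

Lemma L1_theory_imp_mp A B C :
  T (LImp A (LImp B C)) -> T (LImp A B) -> T (LImp A C).
Proof.
move=> /L1_theory_impC BAC AB.
(* Chaining gives [LImp A (LImp A C)]; read as a disjunction, it contracts to [LImp A C]. *)
apply: (L1_theory_orE (LNot A) (LImp A C)).
- exact: L1_theory_imp_trans AB BAC.
- exact/thm/L1_weak.
- exact: L1_theory_imp_refl.
Qed.

(** By the deduction theorem this is the theory generated by [T] and [A]; the implication form
    avoids induction on derivations. *)
Definition L1_extend (A : lform) : set lform := [set B | T (LImp A B)].

Lemma L1_extend_theory A : L1_theory (L1_extend A).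
Proof.
split=> [B tB | B C AB ABC]; first exact/L1_theory_orr/thm.
exact: L1_theory_imp_mp ABC AB.
Qed.

Lemma sub_L1_extend A : T `<=` L1_extend A.
Proof. by move=> B tB; apply: L1_theory_orr. Qed.

Lemma L1_extend_self A : L1_extend A A.
Proof. exact: L1_theory_imp_refl. Qed.

Lemma L1_extend_cases A B : L1_extend A B -> L1_extend (LNot A) B -> T B.
Proof. exact/L1_theory_orE/L1_theory_em. Qed.

End Theory.

Lemma L1_theory_and T (T_theory : L1_theory T) A B : T A -> T B -> T (LAnd A B).
Proof.
move=> tA tB; set D := LOr (LNot A) (LNot B).
(* [LAnd A B] is [LNot D], so only the extension by [D] remains; it is inconsistent, since [D] is
   also [LImp A (LNot B)]. *)
apply: (L1_extend_cases T T_theory D); last exact: L1_extend_self.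
have T'_theory := L1_extend_theory T T_theory D.
have sub := sub_L1_extend T T_theory D.
apply: (L1_theory_absurd _ T'_theory B); first exact: sub.
exact: L1_theory_mp (L1_extend_self T T_theory D) (sub _ tA).
Qed.

Lemma L1_theory_orP T (T_theory : L1_theory T) A B :
  T A \/ T (LNot A) -> T (LOr A B) <-> T A \/ T B.
Proof.
move=> decA; split=> [AB | [tA | tB]]; last 2 first.
- exact: L1_theory_orl.
- exact: L1_theory_orr.
case: decA => [tA | tNA]; [by left | right].
apply: (L1_theory_orE _ T_theory _ _ _ AB); first exact: L1_theory_orl.
exact: L1_theory_imp_refl.
Qed.

(** * Theories deciding the subformulas of a formula *)

(** Deciding subformulas only, instead of all formulas, takes finitely many extensions and no
    maximality argument. *)
Fixpoint decides (T : set lform) (A : lform) : Prop :=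
  (T A \/ T (LNot A)) /\
  match A with
  | LEps _ _ => True
  | LOr A1 A2 => decides T A1 /\ decides T A2
  | LNot A1 => decides T A1
  end.

Lemma decides_root T A : decides T A -> T A \/ T (LNot A).
Proof. by case: A => [a b|A B|A] []. Qed.

Lemma decides_sub T T' A : T `<=` T' -> decides T A -> decides T' A.
Proof.
move=> sub; elim: A => [a b|A IHA B IHB|A IHA] /= [dec decs];
  (split; [by case: dec => /sub; [left | right] | ]) => //.
- by case: decs => /IHA ? /IHB.
- exact: IHA.
Qed.

Lemma extend_decides_root T A C : L1_theory T -> ~ T C ->
  exists T', [/\ L1_theory T', T `<=` T', ~ T' C & T' A \/ T' (LNot A)].
Proof.
move=> T_theory nTC.
(* If adding [A] yields [C], adding [LNot A] cannot, or [T] would contain [C] by excluded middle. *)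
have [AC | nAC] := pselect (L1_extend T A C); last first.
  exists (L1_extend T A); split=> //.
  - exact: L1_extend_theory.
  - exact: sub_L1_extend.
  - by left; apply: L1_extend_self.
exists (L1_extend T (LNot A)); split.
- exact: L1_extend_theory.
- exact: sub_L1_extend.
- by move/(L1_extend_cases _ T_theory _ _ AC).
- by right; apply: L1_extend_self.
Qed.

Lemma extend_decides T A C : L1_theory T -> ~ T C ->
  exists T', [/\ L1_theory T', T `<=` T', ~ T' C & decides T' A].
Proof.
elim: A T => [a b|A IHA B IHB|A IHA] T T_theory nTC.
- have [T' [? ? ? ?]] := extend_decides_root T (LEps a b) C T_theory nTC.
  by exists T'.
- have [T1 [th1 sub1 n1 d1]] := IHA T T_theory nTC.
  have [T2 [th2 sub2 n2 d2]] := IHB T1 th1 n1.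
  have [T3 [th3 sub3 n3 d3]] := extend_decides_root T2 (LOr A B) C th2 n2.
  exists T3; split=> //; first by move=> D /sub1/sub2/sub3.
  split=> //; split; last exact: decides_sub d2.
  by apply: decides_sub d1 => D /sub2/sub3.
- have [T1 [th1 sub1 n1 d1]] := IHA T T_theory nTC.
  have [T2 [th2 sub2 n2 d2]] := extend_decides_root T1 (LNot A) C th1 n1.
  exists T2; split=> //; first by move=> D /sub1/sub2.
  by split=> //; apply: decides_sub d1.
Qed.

Fixpoint max_name (A : lform) : nat :=
  match A with
  | LEps a b => maxn a b
  | LOr A1 A2 => maxn (max_name A1) (max_name A2)
  | LNot A1 => max_name A1
  end.

(** * Forcing of the derived connectives and of translated atoms *)

Lemma forces_imp (U : Type) (G : frame U) V w A B :
  forces G V w (MImp A B) <-> (forces G V w A -> forces G V w B).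
Proof.
split=> [[] // | AB]; have [fA | nA] := pselect (forces G V w A).
  by right; apply: AB.
by left.
Qed.

Lemma forces_and (U : Type) (G : frame U) V w A B :
  forces G V w (MAnd A B) <-> forces G V w A /\ forces G V w B.
Proof.
split=> [/= nAB | [fA fB] [] //].
by split; apply: contrapT => n; apply: nAB; [left | right].
Qed.

Lemma forces_box_imp (U : Type) (G : frame U) V w A B :
  forces G V w (MBox (MImp A B)) <->
  forall v, acc G (w, v) -> forces G V v A -> forces G V v B.
Proof.
split=> AB v wv; last exact/forces_imp/AB.
exact: iffLR (forces_imp _ _ _ _ A B) (AB v wv).
Qed.

Lemma forces_Beps (U : Type) (G : frame U) V w p a b :
  forces G V w (Btrans p (LEps a b)) <->
  [/\ V (p a) w,
      forall v, acc G (w, v) -> V (p a) v -> V (p b) v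
    & V (p b) w -> forall v, acc G (w, v) -> V (p b) v -> V (p a) v].
Proof.
rewrite [Btrans _ _]/=; split.
  move=> /forces_and[/forces_and[aw /forces_box_imp ab] /forces_imp ba].
  by split=> // /ba/forces_box_imp.
case=> aw ab ba; apply/forces_and; split; last first.
  by apply/forces_imp => /ba ?; apply/forces_box_imp.
by apply/forces_and; split=> //; apply/forces_box_imp.
Qed.

(** * The fan model of a theory *)

Section FanModel.
Variables (U : Type) (G : frame U) (star : U) (g : nat -> U) (N : nat).
Hypothesis star_g : forall j, j <= N -> star <> g j.
Hypothesis g_inj : forall j k, j <= N -> k <= N -> g j = g k -> j = k.
Hypothesis acc_star :
  forall v, acc G (star, v) <-> exists2 j, j <= N & v = g j.
Variables (p : name -> pvar) (p_inj : injective p).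
Variables (T : set lform) (T_theory : L1_theory T).

(** Quantifying over [a] stands in for an inverse of [p]; variables outside its range are false
    everywhere. *)
Definition fan_val (q : pvar) : set U :=
  [set x | exists2 a, p a = q &
     (x = star /\ T (LEps a a)) \/
     (exists2 k, k <= N & x = g k /\ T (LEps k a))].

Lemma fan_val_star a : fan_val (p a) star <-> T (LEps a a).
Proof.
split=> [[b /p_inj -> [[]//|[k /star_g ks []]//]] | Ta].
by exists a => //; left.
Qed.

Lemma fan_val_g k a : k <= N -> fan_val (p a) (g k) <-> T (LEps k a).
Proof.
move=> kN; split=> [[b /p_inj -> [[/esym/star_g]|[j jN []]]] | Tka].
- by move/(_ kN).
- by move/g_inj => ->.
- by exists a => //; right; exists k.
Qed.

Lemma L1_theory_eps_trans a b c :
  T (LEps a b) -> T (LEps b c) -> T (LEps a c).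
Proof.
move=> ab bc; apply: (L1_theory_mp _ T_theory _ _ (T_theory.1 _ (L1_ax2 a b c))).
exact: L1_theory_and.
Qed.

Lemma L1_theory_eps_sym a b : T (LEps a b) -> T (LEps b b) -> T (LEps b a).
Proof.
move=> ab bb; apply: (L1_theory_mp _ T_theory _ _ (T_theory.1 _ (L1_ax3 a b b))).
exact: L1_theory_and.
Qed.

(** The translation has modal depth one, so only [star] and its successors matter. Only [a] is
    bounded, since the witness is [g a]. *)
Lemma fan_forces_eps a b : a <= N ->
  forces G fan_val star (Btrans p (LEps a b)) <-> T (LEps a b).
Proof.
move=> aN; split=> [/forces_Beps [/fan_val_star aa ab _] | ab].
  apply/(fan_val_g a b aN)/ab; first by apply/acc_star; exists a.
  exact/fan_val_g.
apply/forces_Beps; split.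
- apply/fan_val_star.
  exact: (L1_theory_mp _ T_theory _ _ (T_theory.1 _ (L1_ax1 a b))).
- move=> _ /acc_star[j jN ->] /(fan_val_g j a jN) ja.
  exact/(fan_val_g j b jN)/(L1_theory_eps_trans j a b).
(* The guard [p b] at [star] supplies [LEps b b], which turns [LEps a b] into [LEps b a]. *)
- move=> /fan_val_star bb _ /acc_star[j jN ->] /(fan_val_g j b jN) jb.
  exact/(fan_val_g j a jN)/(L1_theory_eps_trans j b a)/L1_theory_eps_sym.
Qed.

Lemma fan_forces C A : ~ T C -> max_name A <= N -> decides T A ->
  forces G fan_val star (Btrans p A) <-> T A.
Proof.
move=> nTC; elim: A => [a b|A IHA B IHB|A IHA].
- by move=> /=; rewrite geq_max => /andP[aN _] _; apply: fan_forces_eps.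
- move=> /=; rewrite geq_max => /andP[AN BN] [_ [dA dB]].
  rewrite (IHA AN dA) (IHB BN dB).
  exact: iff_sym (L1_theory_orP T T_theory A B (decides_root T A dA)).
(* One direction uses that [T] decides [A], the other that [T] is consistent, as it omits [C]. *)
- move=> /= AN [_ dA]; rewrite (IHA AN dA); split=> [nA | tNA tA].
    by case: (decides_root _ _ dA).
  exact/nTC/(L1_theory_absurd T T_theory A).
Qed.

End FanModel.

Theorem theorem7p7
  (p : name -> pvar) (p_inj : injective p)
  (X : set mform) (X_normal : normal_logic X)
  (U : Type)
  (I : Type) (omega : nat -> I) (omega_inj : injective omega)
  (F : I -> frame U)
  (F_inf : forall alpha, world (F alpha) !=set0 /\ infinite_set (world (F alpha)))
  (X_complete : complete_wrt X (range F))
  (star : U) (g : nat -> U) (eta : nat -> nat -> U)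
  (eta_inj : forall i, injective (eta i))
  (base_distinct : forall i,
     (forall j, j <= i -> star <> g j) /\
     (forall j k, j <= i -> k <= i -> g j = g k -> j = k))
  (base_eta_disj : forall i,
     ([set star] `|` [set g j | j in [set j | j <= i]])
       `&` range (eta i) = set0)
  (H : nat -> frame U)
  (H_world : forall i,
     world (H i) =
       [set star] `|` [set g j | j in [set j | j <= i]] `|` range (eta i))
  (H_acc : forall i,
     acc (H i) =
       [set (star, g j) | j in [set j | j <= i]]
       `|` [set (g j, star) | j in [set j | j <= i]]
       `|` [set e | exists j k, [/\ j <> k, 1 <= j <= i, 1 <= k <= i
                                  & e = (g j, g k)]]
       `|` [set (x, x) | x in range (eta i)])
  (H_sub_F : range H `<=` range F) :
  Bfaithful p X.
Proof.
move=> A XA; apply: contrapT => nA.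
have L1_theory_thm : L1_theory L1_thm by split=> // B C; apply: L1_mp.
(* [A] is both the formula decided and the one kept out. *)
have [T [T_theory _ nTA decA]] := extend_decides L1_thm A A L1_theory_thm nA.
pose N := max_name A.
have [star_g g_inj] := base_distinct N.
have acc_star v : acc (H N) (star, v) <-> exists2 j, j <= N & v = g j.
  rewrite H_acc; split=> [[[[]|]|] | [j jN ->]].
  - by move=> [j jN [<-]]; exists j.
  - by move=> [j /star_g sj [/esym]].
  - by move=> [j [k [_ /andP[_ /star_g sj] _ []]]].
  (* A loop at [star] would put [star] among the points [eta N]. *)
  - move=> [x xN [xs _]]; suff : set0 star by [].
    by rewrite -(base_eta_disj N) -{2}xs; split=> //; left.
  - by left; left; left; exists j.
have [alpha _ F_HN] : range F (H N) by apply: H_sub_F; exists N.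
have valid : frame_valid (H N) (Btrans p A).
  by rewrite -F_HN; apply: (X_complete _).1 XA _ _; exists alpha.
have forcesE := fan_forces U (H N) star g N star_g g_inj acc_star p p_inj T T_theory.
apply/nTA/(forcesE A A nTA (leqnn _) decA).
by apply: valid; rewrite H_world; left; left.
Qed.
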